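(* The critical points of the canonical correlation analysis problem are the pairs $(U,V)\in\mathbb{C}^{p\times k}\times\mathbb{C}^{q\times k}$ where the columns of $U$ are the left singular unit vectors of $A$, the columns of $V$ are the right singular unit vectors of $A$, and corresponding columns have the same singular value. There are $\binom{\min(p,q)}{k}\,k!\,2^k$ critical points.
   Context: Let $X$ and $Y$ be $n\times p$ and $n\times q$ real data matrices, where $n$ is the common sample size, and let $S_X,S_Y,S_{XY}$ denote the sample covariance matrices, with Cholesky factorizations $S_X=P^TP$ and $S_Y=Q^TQ$, where $P,Q$ are upper triangular. Set $A=P^{-T}S_{XY}Q^{-1}$, a $p\times q$ matrix. After the substitution $u=Pa$, $v=Qb$ for the canonical correlation loadings $(a,b)$, canonical correlation analysis successively seeks pairs $(u_1,v_1),\ldots,(u_k,v_k)$, which are collected as the columns of a $p\times k$ matrix $U=[u_1\cdots u_k]$ and a $q\times k$ matrix $V=[v_1\cdots v_k]$. The pair $(U,V)\in\mathbb{C}^{p\times k}\times\mathbb{C}^{q\times k}$ is called a critical point of the canonical correlation analysis problem if for all $i=1,\ldots,k$ the pair $(u_i,v_i)$ is a critical point of the following optimization problem in $(u,v)\in\mathbb{C}^p\times\mathbb{C}^q$ (with $u_j,v_j$ for $j<i$ fixed): maximize $u^TAv$ subject to $u^Tu=v^Tv=1$, $u^Tu_j=u^TAv_j=0$ and $v^TA^Tu_j=v^Tv_j=0$ for $j=1,\ldots,i-1$. Here a critical point is a point $(u,v)$ satisfying the constraints at which the gradient of the objective $u^TAv$ lies in the linear span of the gradients of the constraint polynomials.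 Singular values and left and right singular vectors are those of the singular value decomposition of $A$; ''unit'' means $u^Tu=1$, respectively $v^Tv=1$.
   Formalization: A is assumed to have min(p,q) distinct positive singular values, and columns use distinct singular values. The count with 2^k is for critical points with all u_i^T A v_i > 0; the total number of critical points is the same with 4^k, since signs of u_i and v_i are independent. *)

(* Defs.v *)
From HB Require Import structures.
From mathcomp Require Import all_boot all_order all_algebra.
From mathcomp Require Import complex mpoly.

Set Implicit Arguments.
Unset Strict Implicit.
Unset Printing Implicit Defensive.

Import Order.TTheory GRing.Theory Num.Theory.

Local Open Scope ring_scope.
Local Open Scope complex_scope.

Definition center_cols (R : fieldType) n p (X : 'M[R]_(n, p)) : 'M[R]_(n, p) :=
  \matrix_(i, j) (X i j - n%:R^-1 * \sum_l X l j).

(* Rows are observations.  The normalisation [n - 1] is the unbiased one; the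
   matrix [cca_matrix] below does not depend on this choice, since rescaling
   all covariances by [c] rescales both Cholesky factors by [sqrt c]. *)
Definition sample_cov (R : fieldType) n p q (X : 'M[R]_(n, p))
    (Y : 'M[R]_(n, q)) : 'M[R]_(p, q) :=
  n.-1%:R^-1 *: ((center_cols X)^T *m center_cols Y).

(* [is_trig_mx] means lower triangular, so [P] itself is upper triangular. *)
Definition cholesky (R : fieldType) p (S P : 'M[R]_p) : Prop :=
  [/\ is_trig_mx P^T, P \in unitmx & S = P^T *m P].

Definition cca_matrix (R : fieldType) n p q (X : 'M[R]_(n, p))
    (Y : 'M[R]_(n, q)) (P : 'M[R]_p) (Q : 'M[R]_q) : 'M[R]_(p, q) :=
  (invmx P)^T *m sample_cov X Y *m invmx Q.

Definition mx1_val (T : Type) (M : 'M[T]_1) : T := M ord0 ord0.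

Definition gradient (F : fieldType) m (f : {mpoly F[m]}) (x : 'cV[F]_m) :
    'cV[F]_m :=
  \col_l (f^`M(l)).@[fun i => x i ord0].

Definition constrained_critical (F : fieldType) m (f : {mpoly F[m]})
    (cs : seq {mpoly F[m]}) (x : 'cV[F]_m) : Prop :=
  (forall c, c \in cs -> c.@[fun i => x i ord0] = 0) /\
  gradient f x \in <<[seq gradient c x | c <- cs]>>%VS.

Section CCA.
Variables (F : fieldType) (p q k : nat) (A : 'M[F]_(p, q)).

(* The generic point [(u, v)]: the first [p] of the [p + q] variables are the
   coordinates of [u], the last [q] those of [v]. *)
Definition var_u : 'cV[{mpoly F[p + q]}]_p := \col_i 'X_(lshift q i).
Definition var_v : 'cV[{mpoly F[p + q]}]_q := \col_j 'X_(rshift p j).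

Definition cst_mx m n (M : 'M[F]_(m, n)) : 'M[{mpoly F[p + q]}]_(m, n) :=
  map_mx (@mpolyC (p + q) F) M.

Definition cca_objective : {mpoly F[p + q]} :=
  mx1_val (var_u^T *m cst_mx A *m var_v).

Definition cca_unit_constraints : seq {mpoly F[p + q]} :=
  [:: mx1_val (var_u^T *m var_u) - 1; mx1_val (var_v^T *m var_v) - 1].

Definition cca_orth_constraints (u' : 'cV[F]_p) (v' : 'cV[F]_q) :
    seq {mpoly F[p + q]} :=
  [:: mx1_val (var_u^T *m cst_mx u');
      mx1_val (var_u^T *m cst_mx A *m cst_mx v');
      mx1_val (var_v^T *m (cst_mx A)^T *m cst_mx u');
      mx1_val (var_v^T *m cst_mx v')].

Definition cca_constraints (U : 'M[F]_(p, k)) (V : 'M[F]_(q, k)) (i : 'I_k) :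
    seq {mpoly F[p + q]} :=
  cca_unit_constraints ++
  flatten [seq cca_orth_constraints (col j U) (col j V)
          | j : 'I_k <- enum 'I_k & (j < i)%N].

Definition cca_critical (U : 'M[F]_(p, k)) (V : 'M[F]_(q, k)) : Prop :=
  forall i : 'I_k,
    constrained_critical cca_objective (cca_constraints U V i)
      (col_mx (col i U) (col i V)).

End CCA.

(* Over the complex numbers [0 <= s] forces [s] to be real; lengths are taken
   with the bilinear form [u^T u], not with the Hermitian one. *)
Definition singular_triple (F : numFieldType) p q (A : 'M[F]_(p, q)) (s : F)
    (u : 'cV[F]_p) (v : 'cV[F]_q) : Prop :=
  [/\ 0 <= s, u^T *m u = 1%:M, v^T *m v = 1%:M,
      A *m v = s *: u & A^T *m u = s *: v].

Definition singular_value (F : numFieldType) p q (A : 'M[F]_(p, q)) (s : F) :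
    Prop :=
  exists u v, singular_triple A s u v.

Definition left_singular_unit_vector (F : numFieldType) p q
    (A : 'M[F]_(p, q)) (s : F) (u : 'cV[F]_p) : Prop :=
  exists v, singular_triple A s u v.

Definition right_singular_unit_vector (F : numFieldType) p q
    (A : 'M[F]_(p, q)) (s : F) (v : 'cV[F]_q) : Prop :=
  exists u, singular_triple A s u v.

Definition distinct_positive_singular_values (F : numFieldType) p q
    (A : 'M[F]_(p, q)) : Prop :=
  exists2 s : 'I_(minn p q) -> F,
    injective s & forall i, 0 < s i /\ singular_value A (s i).

Definition complexify (R : rcfType) p q (A : 'M[R]_(p, q)) : 'M[R[i]]_(p, q) :=
  map_mx (fun x => x%:C) A.

(* [u_i^T A v_i], the value of the objective at the [i]-th column pair. *)
Definition cca_value (F : fieldType) p q k (A : 'M[F]_(p, q))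
    (U : 'M[F]_(p, k)) (V : 'M[F]_(q, k)) (i : 'I_k) : F :=
  mx1_val ((col i U)^T *m A *m col i V).

Definition has_exactly (T : eqType) (E : T -> Prop) (N : nat) : Prop :=
  exists s : seq T, [/\ uniq s, forall x, x \in s <-> E x & size s = N].

(* Main.v *)
Require Import Defs.
From HB Require Import structures.
From mathcomp Require Import all_boot all_order all_algebra.
From mathcomp Require Import complex mpoly.

Set Implicit Arguments.
Unset Strict Implicit.
Unset Printing Implicit Defensive.

Import Order.TTheory GRing.Theory Num.Theory.

Local Open Scope ring_scope.
Local Open Scope complex_scope.

(** The gradients are explicit.  At a point [(u, v)] the objective has gradient
    [(A v, A^T u)], the unit constraints have gradients [(2u, 0)] and [(0, 2v)],
    and each earlier pair [(u_j, v_j)] contributes [(u_j, 0)], [(A v_j, 0)],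
    [(0, A^T u_j)] and [(0, v_j)].  Suppose that the earlier pairs satisfy
    [A v_j = s_j u_j] and [A^T u_j = s_j v_j].  Then their contributions lie in
    the span of the vectors [(u_j, 0)] and [(0, v_j)].  The constraints make
    [A v] orthogonal to every [u_j] and [A^T u] orthogonal to every [v_j], so
    these contributions cancel and what is left is [A v = l u], [A^T u = l' v],
    with [l = u^T A v = l'].  By induction on the column index, a critical point
    is the same thing as a pair of matrices with orthonormal columns whose
    corresponding columns satisfy these equations ([cca_criticalP]).

    It remains to solve [A y = l x], [A^T x = l y] for unit vectors that may be
    complex.  Let [s_i, u_i, v_i], for [i < min(p, q)], be the real singular
    system of [A], with distinct positive [s_i].  If [p <= q], the
    [u_i] form an orthonormal basis.  The coordinates of [x] in this basis satisfy
    [l ^+ 2 * c_i = s_i ^+ 2 * c_i]; as the squares [s_i ^+ 2] are distinct,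
    only one coordinate is nonzero, and since its square is 1, [x] is [u_i] up
    to sign.  Then [y] is [v_i] up to sign, because [s_i] is nonzero.  The other
    case is the transposed one ([singular_pair_in_system]).

    Hence critical points correspond to an injective choice of indices together
    with one sign per column of [U] and one per column of [V]
    ([critical_frameP]), which gives [4 ^ k] sign patterns per choice.  The
    objective at a pair is [s_i] times the product of the two signs; requiring
    it to be positive forces the signs to agree and leaves [2 ^ k] patterns. *)

(** * The bilinear dot product *)

Section Dot.
Variable F : fieldType.

Definition dot n (x y : 'cV[F]_n) : F := mx1_val (x^T *m y).

Lemma dotE n (x y : 'cV[F]_n) : dot x y = \sum_l x l 0 * y l 0.
Proof. by rewrite /dot /mx1_val mxE; apply: eq_bigr => l _; rewrite mxE. Qed.

Lemma dotC n (x y : 'cV[F]_n) : dot x y = dot y x.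
Proof. by rewrite !dotE; apply: eq_bigr => l _; rewrite mulrC. Qed.

Lemma dotDr n (x y z : 'cV[F]_n) : dot x (y + z) = dot x y + dot x z.
Proof. by rewrite /dot mulmxDr /mx1_val mxE. Qed.

Lemma dotZr n c (x y : 'cV[F]_n) : dot x (c *: y) = c * dot x y.
Proof. by rewrite /dot -scalemxAr /mx1_val mxE. Qed.

Lemma dotZl n c (x y : 'cV[F]_n) : dot (c *: x) y = c * dot x y.
Proof. by rewrite dotC dotZr dotC. Qed.

Lemma dot0r n (x : 'cV[F]_n) : dot x 0 = 0.
Proof. by rewrite /dot mulmx0 /mx1_val mxE. Qed.

Lemma dot_adjoint p q (A : 'M[F]_(p, q)) x y :
  dot x (A *m y) = dot y (A^T *m x).
Proof. by rewrite dotC /dot trmx_mul mulmxA. Qed.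

Lemma dot_trmx_mul n (x y : 'cV[F]_n) : x^T *m y = (dot x y)%:M.
Proof. by rewrite [LHS]mx11_scalar. Qed.

Lemma dot_eq1 n (x : 'cV[F]_n) : x^T *m x = 1%:M <-> dot x x = 1.
Proof.
rewrite dot_trmx_mul; split=> [|-> //].
by move/(congr1 (fun M : 'M_1 => M 0 0)); rewrite !mxE.
Qed.

Lemma unit_neq0 n (x : 'cV[F]_n) : dot x x = 1 -> x != 0.
Proof.
by move=> x1; apply: contraPneq x1 => ->; rewrite dot0r => /esym/eqP; rewrite oner_eq0.
Qed.

(** For at least [p] orthonormal vectors the matrix [M] with rows [u i] has rank
    [p], hence a left inverse, so a vector is determined by its coordinates
    [M *m x].  This replaces a positivity argument, which is not available for
    the bilinear form over the complex numbers. *)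
Lemma orthonormal_complete m p (u : 'I_m -> 'cV[F]_p) (x y : 'cV[F]_p) :
  (p <= m)%N -> (forall i j, dot (u i) (u j) = (i == j)%:R) ->
  (forall i, dot (u i) x = dot (u i) y) -> x = y.
Proof.
move=> lepm orth exy; pose M := \matrix_(i < m, l < p) u i l 0.
have ME (z : 'cV_p) i : (M *m z) i 0 = dot (u i) z.
  by rewrite mxE dotE; apply: eq_bigr => l _; rewrite !mxE.
have MM : M *m M^T = 1%:M.
  apply/matrixP=> i j; rewrite !mxE -orth dotE.
  by apply: eq_bigr => l _; rewrite !mxE.
have /row_fullP[B BM] : row_full M.
  rewrite /row_full eqn_leq rank_leq_col (leq_trans lepm) //.
  by apply: (@mulmx1_min_rank _ _ _ _ _ 1%:M M^T); rewrite mul1mx.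
rewrite -[x]mul1mx -[y]mul1mx -BM -!mulmxA; congr (_ *m _).
by apply/matrixP=> i j; rewrite ord1 !ME.
Qed.

(** Induction on membership in a span, so that the multipliers of the individual
    constraints never have to be named. *)
Lemma span_ind (vT : vectType F) (X : seq vT) (Pr : vT -> Prop) :
  Pr 0 -> (forall c x y, Pr x -> Pr y -> Pr (c *: x + y)) ->
  (forall x, x \in X -> Pr x) -> forall w, w \in <<X>>%VS -> Pr w.
Proof.
move=> P0 PD PX w /(@coord_span _ _ _ (in_tuple X)) ->.
elim/big_ind: _ => // [x y Px Py | i _]; first by rewrite -[x]scale1r; apply: PD.
by rewrite -[_ *: _]addr0; apply: PD => //; apply/PX/mem_nth/ltn_ord.
Qed.
End Dot.

(** * Gradients of the objective and of the constraints *)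

Section Gradients.
Variables (F : fieldType) (p q : nat) (A : 'M[F]_(p, q)).
Variables (u : 'cV[F]_p) (v : 'cV[F]_q).

Local Notation var_u := (var_u F p q).
Local Notation var_v := (var_v F p q).
(* [ev] evaluates polynomial matrices at [(u, v)] and [D l] differentiates them
   entrywise; together they compute gradients by the Leibniz rule for matrix
   products. *)
Local Notation pt := (fun l => col_mx u v l ord0).
Local Notation ev := (map_mx (meval pt)).
Local Notation D l := (map_mx (mderiv l)).

Lemma ev_var_u : ev var_u = u.
Proof. by apply/matrixP=> i j; rewrite !mxE mevalXU (ord1 j) col_mxEu. Qed.

Lemma ev_var_v : ev var_v = v.
Proof. by apply/matrixP=> i j; rewrite !mxE mevalXU (ord1 j) col_mxEd. Qed.

Lemma ev_cst m n (M : 'M_(m, n)) : ev (cst_mx p q M) = M.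
Proof. by apply/matrixP=> i j; rewrite !mxE mevalC. Qed.

Lemma mderivXU (n : nat) (i j : 'I_n) : ('X_j : {mpoly F[n]})^`M(i) = (j == i)%:R.
Proof.
rewrite mderivX mnm1E; case: eqP => [->|_]; last by rewrite scale0r.
by rewrite -{1}[U_(i)%MM]add0m addmK mpolyX0 scale1r.
Qed.

Lemma mderiv_mx_cst l m n (M : 'M[F]_(m, n)) : D l (cst_mx p q M) = 0.
Proof. by apply/matrixP=> i j; rewrite !mxE mderivC. Qed.

Lemma mderiv_mxM l m n r (M : 'M[{mpoly F[p + q]}]_(m, n)) (N : 'M_(n, r)) :
  D l (M *m N) = D l M *m N + M *m D l N.
Proof.
apply/matrixP=> i j; rewrite !mxE raddf_sum -big_split /=.
by apply: eq_bigr => h _; rewrite mderivM !mxE.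
Qed.

Lemma mderiv_u_var_u i : D (lshift q i) var_u = delta_mx i 0.
Proof.
by apply/matrixP=> h j; rewrite !mxE mderivXU (ord1 j) eqxx andbT eq_shift.
Qed.

Lemma mderiv_v_var_u j : D (rshift p j) var_u = 0.
Proof. by apply/matrixP=> h i; rewrite !mxE mderivXU eq_lrshift. Qed.

Lemma mderiv_u_var_v i : D (lshift q i) var_v = 0.
Proof. by apply/matrixP=> h j; rewrite !mxE mderivXU eq_rlshift. Qed.

Lemma mderiv_v_var_v j : D (rshift p j) var_v = delta_mx j 0.
Proof.
by apply/matrixP=> h i; rewrite !mxE mderivXU (ord1 i) eqxx andbT eq_shift.
Qed.

Lemma meval_mx1_val (M : 'M_1) : (mx1_val M).@[pt] = mx1_val (ev M).
Proof. by rewrite /mx1_val mxE. Qed.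

Lemma gradient_mx1_val (M : 'M_1) :
  gradient (mx1_val M) (col_mx u v) = \col_l mx1_val (ev (D l M)).
Proof. by apply/matrixP=> l j; rewrite /mx1_val !mxE. Qed.

Lemma gradientB1 (f : {mpoly F[p + q]}) x : gradient (f - 1) x = gradient f x.
Proof. by apply/matrixP=> l j; rewrite !mxE raddfB /= -mpolyC1 mderivC subr0. Qed.

(** Normalises [ev (D l M)] when [M] is a product of constants, [var_u] and
    [var_v]. *)
Definition derivE := (mderiv_mxM, =^~ map_trmx, mderiv_mx_cst, mderiv_u_var_u,
  mderiv_v_var_u, mderiv_u_var_v, mderiv_v_var_v,
  map_mxD, map_mxM, map_delta_mx, map_mx0, trmx0, trmx_delta,
  ev_cst, ev_var_u, ev_var_v, mul0mx, mulmx0, addr0, add0r).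

Lemma delta_mx1_val n (i : 'I_n) (x : 'cV[F]_n) : mx1_val (delta_mx 0 i *m x) = x i 0.
Proof. by rewrite -rowE /mx1_val mxE. Qed.

Lemma mx1_val_delta n (i : 'I_n) (x : 'rV[F]_n) : mx1_val (x *m delta_mx i 0) = x 0 i.
Proof. by rewrite -colE /mx1_val mxE. Qed.

Lemma mx1_valD (M N : 'M[F]_1) : mx1_val (M + N) = mx1_val M + mx1_val N.
Proof. by rewrite /mx1_val mxE. Qed.

Lemma col_mx_ext (f : 'cV[F]_(p + q)) (x : 'cV_p) (y : 'cV_q) :
  (forall i, f (lshift q i) 0 = x i 0) -> (forall j, f (rshift p j) 0 = y j 0) ->
  f = col_mx x y.
Proof.
move=> fx fy; rewrite -[f]vsubmxK; congr col_mx.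
  by apply/matrixP=> i j; rewrite ord1 !mxE fx.
by apply/matrixP=> i j; rewrite ord1 !mxE fy.
Qed.

Lemma gradient_objective :
  gradient (cca_objective A) (col_mx u v) = col_mx (A *m v) (A^T *m u).
Proof.
rewrite gradient_mx1_val; apply: col_mx_ext => i; rewrite mxE !derivE.
  by rewrite -mulmxA delta_mx1_val.
by rewrite mx1_val_delta -[A in LHS]trmxK -trmx_mul mxE.
Qed.

Lemma gradient_unit_u :
  gradient (mx1_val (var_u^T *m var_u) - 1) (col_mx u v) = col_mx (u *+ 2) 0.
Proof.
rewrite gradientB1 gradient_mx1_val; apply: col_mx_ext => i; rewrite [LHS]mxE !derivE.
  by rewrite mx1_valD delta_mx1_val mx1_val_delta mulr2n !mxE.
by rewrite /mx1_val !mxE.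
Qed.

Lemma gradient_unit_v :
  gradient (mx1_val (var_v^T *m var_v) - 1) (col_mx u v) = col_mx 0 (v *+ 2).
Proof.
rewrite gradientB1 gradient_mx1_val; apply: col_mx_ext => i; rewrite [LHS]mxE !derivE.
  by rewrite /mx1_val !mxE.
by rewrite mx1_valD delta_mx1_val mx1_val_delta mulr2n !mxE.
Qed.

Lemma gradient_linear_u (a : 'cV_p) :
  gradient (mx1_val (var_u^T *m cst_mx p q a)) (col_mx u v) = col_mx a 0.
Proof.
rewrite gradient_mx1_val; apply: col_mx_ext => i; rewrite [LHS]mxE !derivE.
  by rewrite delta_mx1_val.
by rewrite /mx1_val !mxE.
Qed.

Lemma gradient_linear_v (b : 'cV_q) :
  gradient (mx1_val (var_v^T *m cst_mx p q b)) (col_mx u v) = col_mx 0 b.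
Proof.
rewrite gradient_mx1_val; apply: col_mx_ext => i; rewrite [LHS]mxE !derivE.
  by rewrite /mx1_val !mxE.
by rewrite delta_mx1_val.
Qed.

Lemma meval_unit_u : (mx1_val (var_u^T *m var_u) - 1).@[pt] = dot u u - 1.
Proof. by rewrite mevalB meval1 meval_mx1_val !derivE. Qed.

Lemma meval_unit_v : (mx1_val (var_v^T *m var_v) - 1).@[pt] = dot v v - 1.
Proof. by rewrite mevalB meval1 meval_mx1_val !derivE. Qed.

Lemma meval_linear_u (a : 'cV_p) :
  (mx1_val (var_u^T *m cst_mx p q a)).@[pt] = dot u a.
Proof. by rewrite meval_mx1_val !derivE. Qed.

Lemma meval_linear_v (b : 'cV_q) :
  (mx1_val (var_v^T *m cst_mx p q b)).@[pt] = dot v b.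
Proof. by rewrite meval_mx1_val !derivE. Qed.

(** All four constraints are linear in [u] alone or in [v] alone, so
    [gradient_linear_u] and [gradient_linear_v] cover them. *)
Lemma orth_constraintsE (u' : 'cV_p) (v' : 'cV_q) :
  cca_orth_constraints A u' v' =
    [:: mx1_val (var_u^T *m cst_mx p q u');
        mx1_val (var_u^T *m cst_mx p q (A *m v'));
        mx1_val (var_v^T *m cst_mx p q (A^T *m u'));
        mx1_val (var_v^T *m cst_mx p q v')].
Proof. by rewrite /cca_orth_constraints /cst_mx !map_mxM !mulmxA map_trmx. Qed.
End Gradients.

(** * Critical points are orthonormal families of signed singular pairs *)

Section Critical.
Variables (F : fieldType) (p q k : nat) (A : 'M[F]_(p, q)).

(** The sign of [s] is free: the Lagrange multiplier of a critical point is a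
    singular value only up to sign. *)
Definition singular_pair (s : F) (u : 'cV[F]_p) (v : 'cV[F]_q) : Prop :=
  [/\ dot u u = 1, dot v v = 1, A *m v = s *: u & A^T *m u = s *: v].

(** Criticality of the [i]-th pair with every evaluation and gradient worked out:
    the Lagrange condition in terms of vectors only. *)
Lemma critical_pointP (U : 'M[F]_(p, k)) (V : 'M[F]_(q, k)) (i : 'I_k) :
  let u := col i U in let v := col i V in
  let prior := flatten [seq
    [:: col_mx (col j U) 0; col_mx (A *m col j V) 0;
        col_mx 0 (A^T *m col j U); col_mx 0 (col j V)]
    | j : 'I_k <- enum 'I_k & (j < i)%N] in
  constrained_critical (cca_objective A) (cca_constraints A U V i) (col_mx u v) <->
  [/\ dot u u = 1, dot v v = 1,
     forall j : 'I_k, (j < i)%N ->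
       [/\ dot u (col j U) = 0, dot u (A *m col j V) = 0,
           dot v (A^T *m col j U) = 0 & dot v (col j V) = 0] &
     col_mx (A *m v) (A^T *m u) \in
       <<[:: col_mx (u *+ 2) 0; col_mx 0 (v *+ 2)] ++ prior>>%VS].
Proof.
move=> u v prior; rewrite /constrained_critical /cca_constraints map_cat.
rewrite gradient_objective /= gradient_unit_u gradient_unit_v.
have -> : [seq gradient c (col_mx u v) | c <- flatten
    [seq cca_orth_constraints A (col j U) (col j V)
       | j : 'I_k <- enum 'I_k & (j < i)%N]] = prior.
  rewrite map_flatten -map_comp; congr flatten; apply: eq_map => j.
  by rewrite /comp orth_constraintsE /= !gradient_linear_u !gradient_linear_v.
split=> [[ev0 grad]|[u1 v1 orth grad]]; split=> //.
- by apply/eqP; rewrite -subr_eq0 -(meval_unit_u u v) ev0 // mem_head.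
- by apply/eqP; rewrite -subr_eq0 -(meval_unit_v u v) ev0 // !inE eqxx orbT.
- move=> j ltji.
  have ev0' c : c \in cca_orth_constraints A (col j U) (col j V) ->
      c.@[fun l => col_mx u v l ord0] = 0.
    move=> cj; apply: ev0; rewrite 2!in_cons; do 2![apply/orP; right].
    by apply/flattenP; exists (cca_orth_constraints A (col j U) (col j V)) => //;
      apply: map_f; rewrite mem_filter ltji mem_enum.
  move: ev0'; rewrite orth_constraintsE => ev0'; split.
  + by rewrite -(ev0' _ (mem_head _ _)) meval_linear_u.
  + by rewrite -[LHS](meval_linear_u u v) ev0' // !inE eqxx orbT.
  + by rewrite -[LHS](meval_linear_v u v) ev0' // !inE eqxx !orbT.
  + by rewrite -[LHS](meval_linear_v u v) ev0' // !inE eqxx !orbT.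
move=> c; rewrite 2!in_cons => /or3P[/eqP->|/eqP->|].
- by rewrite meval_unit_u u1 subrr.
- by rewrite meval_unit_v v1 subrr.
case/flattenP=> cs /mapP[j]; rewrite mem_filter => /andP[ltji _] ->.
have [o1 o2 o3 o4] := orth j ltji.
rewrite orth_constraintsE !inE => /or4P[] /eqP->.
- by rewrite meval_linear_u.
- by rewrite meval_linear_u.
- by rewrite meval_linear_v.
- by rewrite meval_linear_v.
Qed.

Definition orthonormal_cols n (W : 'M[F]_(n, k)) : Prop :=
  forall j l : 'I_k, dot (col j W) (col l W) = (j == l)%:R.

(** The orthogonal projection onto the columns of [W] of index below [i], when
    the columns are orthonormal. *)
Definition proj_cols n (W : 'M[F]_(n, k)) (i : 'I_k) (x : 'cV[F]_n) : 'cV[F]_n :=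
  \sum_(j < k | (j < i)%N) dot (col j W) x *: col j W.

Lemma proj_cols_linear n (W : 'M[F]_(n, k)) i c x y :
  proj_cols W i (c *: x + y) = c *: proj_cols W i x + proj_cols W i y.
Proof.
rewrite /proj_cols scaler_sumr -big_split; apply: eq_bigr => j _ /=.
by rewrite dotDr dotZr scalerDl scalerA.
Qed.

Lemma proj_cols0 n (W : 'M[F]_(n, k)) i : proj_cols W i 0 = 0.
Proof. by rewrite /proj_cols big1 // => j _; rewrite dot0r scale0r. Qed.

Lemma proj_cols_id n (W : 'M[F]_(n, k)) (i j : 'I_k) c :
  orthonormal_cols W -> (j < i)%N -> proj_cols W i (c *: col j W) = c *: col j W.
Proof.
move=> orthW ltji; rewrite /proj_cols (bigD1 j) //= dotZr orthW eqxx mulr1.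
rewrite big1 ?addr0 // => l /andP[_ /negPf neq].
by rewrite dotZr orthW neq mulr0 scale0r.
Qed.

Lemma proj_cols_orth n (W : 'M[F]_(n, k)) (i : 'I_k) x :
  (forall j : 'I_k, (j < i)%N -> dot (col j W) x = 0) -> proj_cols W i x = 0.
Proof. by move=> orth; rewrite /proj_cols big1 // => j /orth->; rewrite scale0r. Qed.

(** The inductive step.  The contribution [w2] of the earlier pairs to the
    Lagrange condition is fixed by the projections onto the earlier columns,
    because these columns are singular pairs; the constraints send the rest of
    the condition to zero under the same projections, so [w2] vanishes. *)
Lemma critical_singular_pair (U : 'M[F]_(p, k)) (V : 'M[F]_(q, k)) (i : 'I_k) :
  orthonormal_cols U -> orthonormal_cols V ->
  (forall j : 'I_k, (j < i)%N -> exists s, singular_pair s (col j U) (col j V)) ->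
  constrained_critical (cca_objective A) (cca_constraints A U V i)
    (col_mx (col i U) (col i V)) ->
  exists s, singular_pair s (col i U) (col i V).
Proof.
move=> orthU orthV IH /critical_pointP[u1 v1 orth].
rewrite span_cat => /memv_addP[w1 + [w2 w2prior]].
rewrite span_cons span_seq1 => /memv_addP[_ /vlineP[a ->] [_ /vlineP[b ->] ->]].
have [projU projV] : proj_cols U i (usubmx w2) = usubmx w2 /\
                     proj_cols V i (dsubmx w2) = dsubmx w2.
  move: w2 w2prior; apply: span_ind.
  - by rewrite !linear0 !proj_cols0.
  - by move=> c x y [xU xV] [yU yV]; rewrite !linearP !proj_cols_linear xU xV yU yV.
  move=> x /flattenP[xs /mapP[j]]; rewrite mem_filter => /andP[ltji _] ->.
  have [s [_ _ -> ->]] := IH j ltji.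
  have := proj_cols_id 1 orthU ltji; have := proj_cols_id 1 orthV ltji.
  rewrite !scale1r => idV idU.
  by rewrite !inE => /or4P[]/eqP->;
    rewrite !(col_mxKu, col_mxKd) !(proj_cols0, idU, idV, proj_cols_id).
rewrite -[w2]vsubmxK !scale_col_mx !add_col_mx !scaler0 addr0 add0r.
(* The unit constraints contribute the gradients [u *+ 2] and [v *+ 2], so the
   multipliers are twice [a] and [b]. *)
move=> /eq_col_mx[Av Au].
have w2u : usubmx w2 = 0.
  rewrite -projU; apply: proj_cols_orth => j ltji.
  have [ouu ouv ovu ovv] := orth j ltji.
  have := dot_adjoint A (col j U) (col i V).
  rewrite ovu Av -scalerMnr scalerMnl dotDr dotZr (dotC _ (col i U)) ouu mulr0.
  by rewrite add0r.
have w2v : dsubmx w2 = 0.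
  rewrite -projV; apply: proj_cols_orth => j ltji.
  have [ouu ouv ovu ovv] := orth j ltji.
  have := dot_adjoint A (col i U) (col j V).
  rewrite ouv Au -scalerMnr scalerMnl dotDr dotZr (dotC _ (col i V)) ovv mulr0.
  by rewrite add0r.
exists (a *+ 2); split=> //; first by rewrite Av w2u addr0 -scalerMnr scalerMnl.
(* Both multipliers equal the value of the objective. *)
rewrite Au w2v addr0 -scalerMnr scalerMnl; congr (_ *: _).
have := dot_adjoint A (col i U) (col i V).
by rewrite Av Au w2u w2v !addr0 -!scalerMnr !scalerMnl !dotZr u1 v1 !mulr1.
Qed.

(** The orthonormality is read off the constraints for all indices at once, before
    the induction that produces the singular pairs.  Conversely, for orthonormal
    singular pairs the unit constraints alone span the gradient of the objective;
    dividing by 2 is needed there. *)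
Lemma cca_criticalP (U : 'M[F]_(p, k)) (V : 'M[F]_(q, k)) :
  2 != 0 :> F ->
  cca_critical A U V <->
  [/\ orthonormal_cols U, orthonormal_cols V &
     forall i, exists s, singular_pair s (col i U) (col i V)].
Proof.
move=> two; split=> [crit|[orthU orthV pairs] i].
  have orth_lt (i j : 'I_k) : (j < i)%N -> dot (col i U) (col j U) = 0 /\
                                  dot (col i V) (col j V) = 0.
    by have /critical_pointP[_ _ orth _] := crit i; case/orth.
  have orthU : orthonormal_cols U.
    move=> j l; case: (ltngtP j l) => [ltjl|ltlj|/val_inj->].
    - by rewrite dotC (orth_lt _ _ ltjl).1 -val_eqE ltn_eqF.
    - by rewrite (orth_lt _ _ ltlj).1 -val_eqE gtn_eqF.
    - by have /critical_pointP[-> _ _ _] := crit l; rewrite eqxx.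
  have orthV : orthonormal_cols V.
    move=> j l; case: (ltngtP j l) => [ltjl|ltlj|/val_inj->].
    - by rewrite dotC (orth_lt _ _ ltjl).2 -val_eqE ltn_eqF.
    - by rewrite (orth_lt _ _ ltlj).2 -val_eqE gtn_eqF.
    - by have /critical_pointP[_ -> _ _] := crit l; rewrite eqxx.
  split=> // i; have [m] := ubnP i.
  elim: m i => // m IH i /ltnSE leim.
  apply: critical_singular_pair => // j ltji.
  by apply: IH; apply: leq_trans leim.
have [s [u1 v1 Av Au]] := pairs i.
apply/critical_pointP; split=> //.
  move=> j ltji; have neq : (i == j) = false by rewrite -val_eqE gtn_eqF.
  have [t [_ _ Avj Auj]] := pairs j.
  by rewrite Avj Auj !dotZr orthU orthV neq mulr0.
rewrite span_cat; apply: (subvP (addvSl _ _)).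
have -> : col_mx (A *m col i V) (A^T *m col i U) =
    (s / 2) *: col_mx (col i U *+ 2) 0 + (s / 2) *: col_mx 0 (col i V *+ 2).
  rewrite !scale_col_mx add_col_mx !scaler0 addr0 add0r Av Au.
  by rewrite -!scalerMnr !scalerMnl -mulr_natr divfK.
by rewrite memvD // memvZ // memv_span // !inE eqxx ?orbT.
Qed.
End Critical.

(** * Signed singular pairs of a matrix with distinct singular values *)

Section SingularSystem.
Variable F : numFieldType.

Definition singular_system p q m (A : 'M[F]_(p, q)) (s : 'I_m -> F)
    (u : 'I_m -> 'cV[F]_p) (v : 'I_m -> 'cV[F]_q) : Prop :=
  [/\ injective s, forall i, 0 < s i & forall i, singular_pair A (s i) (u i) (v i)].

Definition orthonormal_family n m (w : 'I_m -> 'cV[F]_n) : Prop :=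
  forall i j, dot (w i) (w j) = (i == j)%:R.

Lemma singular_pair_tr p q (A : 'M[F]_(p, q)) s u v :
  singular_pair A s u v -> singular_pair A^T s v u.
Proof. by case=> u1 v1 Av Au; split; rewrite ?trmxK. Qed.

Lemma singular_system_tr p q m (A : 'M[F]_(p, q)) (s : 'I_m -> F) u v :
  singular_system A s u v -> singular_system A^T s v u.
Proof. by case=> sI s0 suv; split=> // i; apply/singular_pair_tr. Qed.

Lemma sqr_eq_sign (x y : F) : x ^+ 2 = y ^+ 2 -> exists e : bool, x = (-1) ^+ e * y.
Proof.
move/eqP; rewrite eqf_sqr => /orP[]/eqP->; [exists false | exists true].
  by rewrite mul1r.
by rewrite mulN1r.
Qed.

(** Moving [A] across the dot product twice gives
    [s i ^+ 2 * d = s j ^+ 2 * d] for [d] the dot product of [u i] and [u j], and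
    distinct positive [s i], [s j] have distinct squares. *)
Lemma system_left_orthonormal p q m (A : 'M[F]_(p, q)) (s : 'I_m -> F) u v :
  singular_system A s u v -> orthonormal_family u.
Proof.
case=> sI s_gt0 suv i j; have [ui1 vi1 Avi Aui] := suv i.
have [uj1 vj1 Avj Auj] := suv j.
case: eqVneq => [<- //|neq]; apply/eqP; apply: contraNT neq => nz.
have e1 : s i * dot (u j) (u i) = s j * dot (v i) (v j).
  by rewrite -dotZr -Avi dot_adjoint Auj dotZr.
have e2 : s i * dot (v i) (v j) = s j * dot (u j) (u i).
  by rewrite (dotC (v i)) -dotZr -Aui -dot_adjoint Avj dotZr dotC.
have : s i ^+ 2 = s j ^+ 2.
  apply: (mulIf nz); rewrite (dotC (u i)).
  by rewrite !expr2 -!mulrA e1 mulrCA e2.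
by move/eqP; rewrite eqrXn2 ?ltW // => /eqP/sI->.
Qed.

Lemma system_right_orthonormal p q m (A : 'M[F]_(p, q)) (s : 'I_m -> F) u v :
  singular_system A s u v -> orthonormal_family v.
Proof. by move/singular_system_tr/system_left_orthonormal. Qed.

(** The coordinates of [x] on the basis [u] satisfy
    [l ^+ 2 * c = s i ^+ 2 * c], so exactly one of them is nonzero and its square
    is 1.  The vector [y] is then recovered from [A^T *m x = l *: y]. *)
Lemma singular_pair_in_wide_system p q m (A : 'M[F]_(p, q)) (s : 'I_m -> F) u v l x y :
  (p <= m)%N -> singular_system A s u v -> singular_pair A l x y ->
  exists i (e d : bool),
    [/\ x = (-1) ^+ e *: u i, y = (-1) ^+ d *: v i & l = (-1) ^+ e * (-1) ^+ d * s i].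
Proof.
move=> lepm sys [x1 y1 Ay Ax]; have [sI s_gt0 suv] := sys.
have orthu := system_left_orthonormal sys.
have eig i : l ^+ 2 * dot (u i) x = s i ^+ 2 * dot (u i) x.
  have [_ _ Avi Aui] := suv i.
  have e1 : l * dot (u i) x = s i * dot (v i) y.
    by rewrite -dotZr -Ay dot_adjoint Aui dotZr dotC.
  have e2 : l * dot (v i) y = s i * dot (u i) x.
    by rewrite -dotZr -Ax -dot_adjoint Avi dotZr dotC.
  by rewrite !expr2 -!mulrA e1 mulrCA e2.
have [i nzi] : exists i, dot (u i) x != 0.
  apply/existsP; apply: contra_neqT (unit_neq0 x1) => /existsPn z.
  apply: (orthonormal_complete lepm orthu) => i.
  by rewrite dot0r; apply/eqP/negbNE/z.
have l2 : l ^+ 2 = s i ^+ 2 by apply: (mulIf nzi).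
have xE : x = dot (u i) x *: u i.
  apply: (orthonormal_complete lepm orthu) => j; rewrite dotZr orthu.
  case: eqVneq => [->|neq]; first by rewrite mulr1.
  rewrite mulr0; apply/eqP; apply: contraNT neq => nz.
  have /eqP := mulIf nz (eig j).
  by rewrite l2 eqrXn2 ?ltW // => /eqP/sI->.
have [e cE] : exists e : bool, dot (u i) x = (-1) ^+ e.
  have [|e ->] := @sqr_eq_sign (dot (u i) x) 1; last by exists e; rewrite mulr1.
  rewrite expr1n -x1 {2 3}xE dotZl dotZr orthu eqxx mulr1 expr2.
  by [].
have [b lE] := sqr_eq_sign l2.
have sE (c d : bool) : (-1) ^+ (c (+) d) = (-1) ^+ c * (-1) ^+ d :> F.
  by rewrite signr_addb.
(* The sign of [y] is fixed by [l *: y = A^T *m x], that is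
   [(-1) ^+ b * s i *: y = (-1) ^+ e * s i *: v i]. *)
exists i, e, (b (+) e); split; first by rewrite -cE.
  have [_ _ _ Aui] := suv i.
  have nzl : l != 0 by rewrite -sqrf_eq0 l2 sqrf_eq0 gt_eqF.
  apply: (scalerI nzl); rewrite -Ax xE cE -scalemxAr Aui !scalerA lE sE.
  by congr (_ *: _); rewrite mulrACA -expr2 sqrr_sign mul1r mulrC.
by rewrite lE sE mulrCA -expr2 sqrr_sign mulr1.
Qed.

Lemma singular_pair_in_system p q m (A : 'M[F]_(p, q)) (s : 'I_m -> F) u v l x y :
  (minn p q <= m)%N -> singular_system A s u v -> singular_pair A l x y ->
  exists i (e d : bool),
    [/\ x = (-1) ^+ e *: u i, y = (-1) ^+ d *: v i & l = (-1) ^+ e * (-1) ^+ d * s i].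
Proof.
rewrite geq_min => /orP[lepm|leqm] sys xy.
  exact: singular_pair_in_wide_system sys xy.
have [i [d [e [-> -> ->]]]] :=
  singular_pair_in_wide_system leqm (singular_system_tr sys) (singular_pair_tr xy).
by exists i, e, d; split=> //; congr (_ * _); rewrite mulrC.
Qed.

Definition signed_cols n m k (w : 'I_m -> 'cV[F]_n) (f : 'I_k -> 'I_m)
    (e : 'I_k -> bool) : 'M[F]_(n, k) :=
  \matrix_(r, i) ((-1) ^+ e i *: w (f i)) r 0.

Lemma col_signed_cols n m k (w : 'I_m -> 'cV[F]_n) (f : 'I_k -> 'I_m) e i :
  col i (signed_cols w f e) = (-1) ^+ e i *: w (f i).
Proof. by apply/matrixP=> r c; rewrite !mxE (ord1 c). Qed.

Lemma eq_signed_cols n m k (w : 'I_m -> 'cV[F]_n) (f : 'I_k -> 'I_m) (e : 'I_k -> bool) W :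
  (forall i, col i W = (-1) ^+ e i *: w (f i)) -> W = signed_cols w f e.
Proof. move=> colW; apply/matrixP=> r i.
by have := colW i; rewrite -(col_signed_cols w f) => /matrixP/(_ r 0); rewrite !mxE. Qed.

Lemma signed_cols_orthonormal n m k (w : 'I_m -> 'cV[F]_n) (f : 'I_k -> 'I_m) e :
  orthonormal_family w ->
  injective f <-> orthonormal_cols (signed_cols w f e).
Proof.
move=> orthw; split=> [fI i j|orth i j fij].
  rewrite !col_signed_cols dotZr dotZl orthw (inj_eq fI).
  by case: eqVneq => [->|]; rewrite ?mulr0 // mulr1 -expr2 sqrr_sign.
apply/eqP; have := orth i j.
rewrite !col_signed_cols dotZr dotZl orthw fij eqxx mulr1.
by case: eqVneq => // _ /eqP; rewrite mulf_eq0 !signr_eq0.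
Qed.

Lemma signed_cols_inj n m k (w : 'I_m -> 'cV[F]_n)
    (f f' : {ffun 'I_k -> 'I_m}) (e e' : {ffun 'I_k -> bool}) :
  orthonormal_family w ->
  signed_cols w f e = signed_cols w f' e' -> f = f' /\ e = e'.
Proof.
move=> orthw eqW.
have eqi i : f i = f' i /\ e i = e' i.
  have := congr1 (fun W => dot (w (f i)) (col i W)) eqW.
  rewrite /= !col_signed_cols !dotZr !orthw eqxx mulr1.
  case: eqVneq => [->|_ /eqP]; last by rewrite mulr0 signr_eq0.
  by rewrite mulr1 => /signr_inj.
by split; apply/ffunP=> i; case: (eqi i).
Qed.
End SingularSystem.

(** * Counting *)

Lemma has_exactly_image (T : finType) (S : eqType) (g : T -> S) (D : {pred T})
    (E : S -> Prop) :
  {in D &, injective g} -> (forall x, E x <-> exists2 t, t \in D & x = g t) ->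
  has_exactly E #|D|.
Proof.
move=> gI DE; exists [seq g t | t <- enum D]; split.
- by rewrite map_inj_in_uniq ?enum_uniq // => x y; rewrite !mem_enum; apply: gI.
- move=> x; rewrite DE; split=> [/mapP[t]|[t Dt ->]].
    by rewrite mem_enum => Dt ->; exists t.
  by apply: map_f; rewrite mem_enum.
- by rewrite size_map -cardE.
Qed.

Lemma card_inj_ord (k m : nat) :
  #|[set f : {ffun 'I_k -> 'I_m} | injectiveb f]| = ('C(m, k) * k`!)%N.
Proof. by rewrite card_inj_ffuns !card_ord bin_ffact. Qed.

Lemma card_sign_patterns (k : nat) : #|{: {ffun 'I_k -> bool}}| = (2 ^ k)%N.
Proof. by rewrite card_ffun card_bool card_ord. Qed.

Section Count.
Variables (F : numFieldType) (p q k : nat) (A : 'M[F]_(p, q)).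
Local Notation m := (minn p q).
Variables (s : 'I_m -> F) (u : 'I_m -> 'cV[F]_p) (v : 'I_m -> 'cV[F]_q).
Hypothesis sys : singular_system A s u v.

(** The parametrisation of critical points used for both the characterisation and
    the counts: which singular pairs are taken, and with which signs. *)
Lemma critical_frameP (U : 'M[F]_(p, k)) (V : 'M[F]_(q, k)) :
  cca_critical A U V <->
  exists (f : {ffun 'I_k -> 'I_m}) (e d : {ffun 'I_k -> bool}),
    [/\ injective f, U = signed_cols u f e & V = signed_cols v f d].
Proof.
have [orthu orthv] := (system_left_orthonormal sys, system_right_orthonormal sys).
have [_ _ suv] := sys.
rewrite cca_criticalP ?pnatr_eq0 //; split; last first.
  move=> [f [e [d [fI -> ->]]]]; split; try exact/signed_cols_orthonormal.
  move=> i; have [ui1 vi1 Av Au] := suv (f i).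
  exists ((-1) ^+ e i * (-1) ^+ d i * s (f i)).
  rewrite !col_signed_cols /singular_pair !dotZr !dotZl ui1 vi1 -!scalemxAr Av Au.
  rewrite !scalerA !mulr1 -!expr2 !sqrr_sign; split=> //; congr (_ *: _).
    by rewrite [RHS]mulrC !mulrA -expr2 sqrr_sign mul1r.
  by rewrite [RHS]mulrC [_ * (-1) ^+ d i]mulrC !mulrA -expr2 sqrr_sign mul1r.
move=> [orthU orthV pairs].
have /fin_all_exists[t tP] i : exists t : 'I_m * (bool * bool),
    col i U = (-1) ^+ t.2.1 *: u t.1 /\ col i V = (-1) ^+ t.2.2 *: v t.1.
  have [l uv] := pairs i.
  have [j [e [d [-> -> _]]]] := singular_pair_in_system (leqnn _) sys uv.
  by exists (j, (e, d)).
pose f := [ffun i => (t i).1]; pose e := [ffun i => (t i).2.1].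
pose d := [ffun i => (t i).2.2].
have UE : U = signed_cols u f e.
  by apply: eq_signed_cols => i; rewrite !ffunE (tP i).1.
have VE : V = signed_cols v f d.
  by apply: eq_signed_cols => i; rewrite !ffunE (tP i).2.
exists f, e, d; split=> //.
by apply/(signed_cols_orthonormal f e orthu); rewrite -UE.
Qed.

Lemma cca_value_signed_cols (f : 'I_k -> 'I_m) (e d : 'I_k -> bool) i :
  cca_value A (signed_cols u f e) (signed_cols v f d) i =
    (-1) ^+ (e i (+) d i) * s (f i).
Proof.
have [_ _ /(_ (f i))[ui1 _ Av _]] := sys.
rewrite /cca_value -mulmxA -/(dot _ _) !col_signed_cols -scalemxAr Av.
by rewrite dotZl !dotZr ui1 mulr1 signr_addb mulrA.
Qed.

(** Positive objective values select one global sign per singular pair, which is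
    the sense in which there are [2 ^ k] rather than [4 ^ k] choices of signs. *)
Lemma cca_value_gt0 (f : 'I_k -> 'I_m) (e d : {ffun 'I_k -> bool}) :
  (forall i, 0 < cca_value A (signed_cols u f e) (signed_cols v f d) i) <-> e = d.
Proof.
have [_ s_gt0 _] := sys.
split=> [pos|-> i]; last by rewrite cca_value_signed_cols addbb mul1r.
apply/ffunP=> i; have := pos i; rewrite cca_value_signed_cols.
by rewrite pmulr_lgt0 // signr_gt0; case: (e i) (d i) => [] [].
Qed.

Lemma count_critical :
  has_exactly (fun UV : 'M[F]_(p, k) * 'M[F]_(q, k) => cca_critical A UV.1 UV.2)
    ('C(m, k) * k`! * 4 ^ k)%N.
Proof.
pose D := [predX [set f : {ffun 'I_k -> 'I_m} | injectiveb f] &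
  {: {ffun 'I_k -> bool} * {ffun 'I_k -> bool}}].
have -> : ('C(m, k) * k`! * 4 ^ k)%N = #|D|.
  by rewrite cardX card_inj_ord card_prod card_sign_patterns -expnMn.
apply: (@has_exactly_image _ _
  (fun t : {ffun 'I_k -> 'I_m} * ({ffun 'I_k -> bool} * {ffun 'I_k -> bool}) =>
    (signed_cols u t.1 t.2.1, signed_cols v t.1 t.2.2))) => [[f [e d]] [f' [e' d']]|[U V]].
  move=> _ _ [/(signed_cols_inj (system_left_orthonormal sys))[-> ->]].
  by move=> /(signed_cols_inj (system_right_orthonormal sys))[_ ->].
rewrite /= critical_frameP; split=> [[f [e [d [fI -> ->]]]]|].
  by exists (f, (e, d)) => //; rewrite !inE andbT; apply/injectiveP.
case=> [[f [e d]]]; rewrite !inE andbT => /injectiveP fI [-> ->].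
by exists f, e, d.
Qed.

Lemma count_positive_critical :
  has_exactly
    (fun UV : 'M[F]_(p, k) * 'M[F]_(q, k) =>
       cca_critical A UV.1 UV.2 /\ forall i, 0 < cca_value A UV.1 UV.2 i)
    ('C(m, k) * k`! * 2 ^ k)%N.
Proof.
pose D := [predX [set f : {ffun 'I_k -> 'I_m} | injectiveb f] & {: {ffun 'I_k -> bool}}].
have -> : ('C(m, k) * k`! * 2 ^ k)%N = #|D|.
  by rewrite cardX card_inj_ord card_sign_patterns.
apply: (@has_exactly_image _ _
  (fun t : {ffun 'I_k -> 'I_m} * {ffun 'I_k -> bool} =>
    (signed_cols u t.1 t.2, signed_cols v t.1 t.2))) => [[f e] [f' e']|[U V]].
  by move=> _ _ [/(signed_cols_inj (system_left_orthonormal sys))[-> ->]].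
rewrite /= critical_frameP; split=> [[[f [e [d [fI -> ->]]]] /cca_value_gt0 <-]|].
  by exists (f, e) => //; rewrite !inE andbT; apply/injectiveP.
case=> [[f e]]; rewrite !inE andbT => /injectiveP fI [-> ->].
by split; [exists f, e, e | apply/cca_value_gt0].
Qed.
End Count.

(** * From the real singular system to the complex one *)

Section Complexification.
Variable R : rcfType.

Lemma complexify_singular_pair p q (A : 'M[R]_(p, q)) s u v :
  singular_pair A s u v ->
  singular_pair (complexify A) s%:C (complexify u) (complexify v).
Proof.
have cE m n (M : 'M[R]_(m, n)) : complexify M = map_mx (real_complex R) M by [].
have dotC n (x : 'cV[R]_n) : dot (complexify x) (complexify x) = (dot x x)%:C.
  by rewrite /dot cE map_trmx -map_mxM /mx1_val mxE.
case=> u1 v1 Av Au; split; rewrite ?dotC ?u1 ?v1 //.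
  by rewrite !cE -map_mxM Av map_mxZ.
by rewrite !cE map_trmx -map_mxM Au map_mxZ.
Qed.

Lemma complexify_singular_system p q (A : 'M[R]_(p, q)) :
  distinct_positive_singular_values A ->
  exists (s : 'I_(minn p q) -> R) u v,
    [/\ injective s, forall i, 0 < s i &
      singular_system (complexify A) (fun i => (s i)%:C) u v].
Proof.
case=> s sI sP.
have /fin_all_exists[w wP] i : exists w : 'cV[R]_p * 'cV[R]_q,
    singular_pair A (s i) w.1 w.2.
  have [_ [u [v [_ u1 v1 Av Au]]]] := sP i.
  by exists (u, v); split=> //; apply/dot_eq1.
exists s, (fun i => complexify (w i).1), (fun i => complexify (w i).2).
have s_gt0 i : 0 < s i by case: (sP i).
split=> //; split=> [i j /complexI/sI //|i|i]; first by rewrite ltcR.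
exact: complexify_singular_pair.
Qed.
End Complexification.

Theorem theorem5p1 (R : rcfType) (n p q k : nat)
    (X : 'M[R]_(n, p)) (Y : 'M[R]_(n, q)) (P : 'M[R]_p) (Q : 'M[R]_q)
    (A : 'M[R]_(p, q))
    (hP : cholesky (sample_cov X X) P)
    (hQ : cholesky (sample_cov Y Y) Q)
    (hA : A = cca_matrix X Y P Q)
    (hgen : distinct_positive_singular_values A) :
  (forall (U : 'M[R[i]]_(p, k)) (V : 'M[R[i]]_(q, k)),
     cca_critical (complexify A) U V <->
     exists2 s : 'I_k -> R,
       injective s &
       forall i : 'I_k,
         left_singular_unit_vector (complexify A) (s i)%:C (col i U) /\
         right_singular_unit_vector (complexify A) (s i)%:C (col i V))
  /\ has_exactly
       (fun UV : 'M[R[i]]_(p, k) * 'M[R[i]]_(q, k) =>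
          cca_critical (complexify A) UV.1 UV.2 /\
          forall i : 'I_k, 0 < cca_value (complexify A) UV.1 UV.2 i)
       ('C(minn p q, k) * k`! * 2 ^ k)%N
  /\ has_exactly
       (fun UV : 'M[R[i]]_(p, k) * 'M[R[i]]_(q, k) =>
          cca_critical (complexify A) UV.1 UV.2)
       ('C(minn p q, k) * k`! * 4 ^ k)%N.
Proof.
have [s [u [v [sI s_gt0 sys]]]] := complexify_singular_system hgen.
split; last by split; [apply: count_positive_critical sys | apply: count_critical sys].
have [_ _ suv] := sys.
(* A singular value is nonnegative, so the sign of the multiplier is determined
   and a single singular vector already tells the index. *)
have triple (l : R) x y : singular_triple (complexify A) l%:C x y ->
    exists i (e d : bool), [/\ x = (-1) ^+ e *: u i, y = (-1) ^+ d *: v i & l = s i].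
  case=> l0 /dot_eq1 x1 /dot_eq1 y1 Ay Ax.
  have xy : singular_pair (complexify A) l%:C x y by [].
  have [i [e [d [xE yE lE]]]] := singular_pair_in_system (leqnn _) sys xy.
  exists i, e, d; split=> //; apply: complexI.
  move: l0; rewrite lE -signr_addb pmulr_lge0 ?ltcR // signr_ge0.
  by case: (e (+) d) => // _; rewrite mul1r.
move=> U V; rewrite (critical_frameP sys); split.
  move=> [f [e [d [fI -> ->]]]]; exists (s \o f); first exact: inj_comp sI fI.
  move=> i; have [u1 v1 Av Au] := suv (f i).
  have s0 : 0 <= (s (f i))%:C by rewrite lecR ltW.
  rewrite !col_signed_cols; split.
    exists ((-1) ^+ e i *: v (f i)); split=> //.
    - by apply/dot_eq1; rewrite dotZl dotZr u1 mulr1 -expr2 sqrr_sign.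
    - by apply/dot_eq1; rewrite dotZl dotZr v1 mulr1 -expr2 sqrr_sign.
    - by rewrite -scalemxAr Av !scalerA mulrC.
    - by rewrite -scalemxAr Au !scalerA mulrC.
  exists ((-1) ^+ d i *: u (f i)); split=> //.
  - by apply/dot_eq1; rewrite dotZl dotZr u1 mulr1 -expr2 sqrr_sign.
  - by apply/dot_eq1; rewrite dotZl dotZr v1 mulr1 -expr2 sqrr_sign.
  - by rewrite -scalemxAr Av !scalerA mulrC.
  - by rewrite -scalemxAr Au !scalerA mulrC.
move=> [l lI UV].
have /fin_all_exists[t tP] i : exists t : 'I_(minn p q) * (bool * bool),
    [/\ col i U = (-1) ^+ t.2.1 *: u t.1, col i V = (-1) ^+ t.2.2 *: v t.1 & l i = s t.1].
  have [[y /triple[a [e [_ [-> _ la]]]]] [x /triple[b [_ [d [_ -> lb]]]]]] := UV i.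
  (* Left and right vectors come with separate partners; they belong to the same
     index because the singular values are distinct. *)
  by exists (a, (e, d)); split=> //=; congr (_ *: v _); apply: sI; rewrite -la -lb.
exists [ffun i => (t i).1], [ffun i => (t i).2.1], [ffun i => (t i).2.2]; split.
- move=> i j; rewrite !ffunE => tij; apply: lI.
  by have [[_ _ ->] [_ _ ->]] := (tP i, tP j); rewrite tij.
- by apply: eq_signed_cols => i; rewrite !ffunE; case: (tP i).
- by apply: eq_signed_cols => i; rewrite !ffunE; case: (tP i).
Qed.
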